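(* Let $\mathfrak{q}=\mathfrak{l}\oplus\mathfrak{g}(1)\oplus\mathfrak{z}(\mathfrak{n})$ be a maximal parabolic subalgebra of quasi-Heisenberg type of one of the types $B_n(i)$ ($3\le i\le n$), $C_n(i)$ ($2\le i\le n-1$), $D_n(i)$ ($3\le i\le n-3$), $E_6(3)$, $E_6(5)$, $E_7(2)$, $E_7(6)$, $E_8(1)$, $F_4(4)$. Then the irreducible constituent $V(\xi_\gamma+\gamma)$ of $\mathfrak{l}_\gamma\otimes\mathfrak{z}(\mathfrak{n})$ is not special.
   Context: $\mathfrak{g}$ is a complex simple Lie algebra with Borel subalgebra $\mathfrak{b}\supset\mathfrak{h}$ (Cartan), roots $\Delta$, simple roots $\Pi$. ''$\mathfrak{q}$ is of type $\mathcal{T}(i)$'' means $\mathfrak{g}$ has type $\mathcal{T}$ and $\mathfrak{q}=\mathfrak{l}\oplus\mathfrak{n}$ is the standard maximal parabolic determined by $\alpha_\mathfrak{q}=\alpha_i$ (Bourbaki numbering): $\mathfrak{l}=\mathfrak{h}$ plus root spaces for roots in $\mathrm{span}(\Pi\setminus\{\alpha_\mathfrak{q}\})$, $\mathfrak{n}$ the remaining positive root spaces. Quasi-Heisenberg type: $[\mathfrak{n},[\mathfrak{n},\mathfrak{n}]]=0$, $\dim[\mathfrak{n},\mathfrak{n}]>1$. $\mathfrak{n}=\mathfrak{g}(1)\oplus\mathfrak{z}(\mathfrak{n})$, where $\mathfrak{g}(1)$ (resp. the center $\mathfrak{z}(\mathfrak{n})$) is the sum of the root spaces of roots with $\alpha_\mathfrak{q}$-coefficient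 $1$ (resp. $2$). $L$ is the Levi subgroup with Lie algebra $\mathfrak{l}$, acting by $\mathrm{Ad}$. $\Delta(W)$ denotes the roots whose root spaces lie in $W$. $\mu$ is the highest weight of the irreducible $L$-module $\mathfrak{g}(1)$ and $\gamma$ (the highest root) that of $\mathfrak{z}(\mathfrak{n})$. $\mathfrak{l}_\gamma$ is the simple ideal of $[\mathfrak{l},\mathfrak{l}]$ containing the root space of the unique simple root not orthogonal to $\gamma$; $\xi_\gamma$ is its highest root. $V(\nu)$ denotes an irreducible $L$-constituent with highest weight $\nu$ (a weight of $\mathfrak{h}$); it is special if $\nu\neq\gamma$ and there is $\epsilon\in\Delta(\mathfrak{g}(1))$ with $\nu=\mu+\epsilon$. *)

(* Defs.v *)
From HB Require Import structures.
From mathcomp Require Import all_boot all_order all_algebra.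
From mathcomp Require Import complex.
From mathcomp Require Import boolp classical_sets reals topology normedtype.

Set Implicit Arguments.
Unset Strict Implicit.
Unset Printing Implicit Defensive.

Import Order.TTheory GRing.Theory Num.Theory.
Import numFieldNormedType.Exports.

Local Open Scope ring_scope.

HB.mixin Record Vector_isLieAlgebra (K : fieldType) g of Vector K g := {
  lie : g -> g -> g;
  lie_linear_l : forall y : g, linear (lie^~ y);
  lie_linear_r : forall x : g, linear (lie x);
  liexx : forall x : g, lie x x = 0;
  lie_jacobi : forall x y z : g,
    lie x (lie y z) + lie y (lie z x) + lie z (lie x y) = 0
}.

#[short(type="lieAlgType")]
HB.structure Definition LieAlgebra (K : fieldType) :=
  {g of Vector_isLieAlgebra K g & Vector K g}.

Section LieAlgebras.
Context {K : fieldType} {g : lieAlgType K}.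
Implicit Types (x y : g) (U V I s h : {vspace g}).

Definition ad x : 'End(g) := linfun (lie x).

Lemma adE x y : ad x y = lie x y.
Proof.
pose m := GRing.isLinear.Build K g g _ (lie x) (@lie_linear_r K g x).
pose f : {linear g -> g} := HB.pack (lie x) m.
by rewrite /ad -[lie x]/(f : g -> g) lfunE.
Qed.

Lemma ad_is_linear : linear ad.
Proof.
move=> a x y; apply/lfunP => z.
by rewrite add_lfunE scale_lfunE !adE lie_linear_l.
Qed.

HB.instance Definition _ :=
  GRing.isLinear.Build K g 'End(g) _ ad ad_is_linear.

Definition bracketv U V : {vspace g} :=
  <<[seq lie u v | u <- vbasis U, v <- vbasis V]>>%VS.

Definition centerv U : {vspace g} :=
  (U :&: \bigcap_(x <- vbasis U) lker (ad x))%VS.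

Definition ideal_of I s : bool := (I <= s)%VS && (bracketv s I <= I)%VS.

Definition simple_subalg s : Prop :=
  [/\ (bracketv s s <= s)%VS, bracketv s s != 0%VS
    & forall I, ideal_of I s -> I = 0%VS \/ I = s].

Definition simple_ideal I s : Prop := ideal_of I s /\ simple_subalg I.

Definition diagonalizable_end (f : 'End(g)) : Prop :=
  exists2 b : seq g, basis_of fullv b
    & {in b, forall v, exists a : K, f v = a *: v}.

(* The usual description of Cartan subalgebras of complex semisimple g. *)
Definition cartan_subalgebra h : Prop :=
  [/\ {in h &, forall x y, lie x y = 0},
      forall x, {in h, forall y, lie x y = 0} -> x \in h
    & {in h, forall x, diagonalizable_end (ad x)}].

Definition trace_end (f : 'End(g)) : K :=
  \sum_i coord (vbasis {:g}) i (f (vbasis {:g})`_i).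

Definition killing x y : K := trace_end (ad x \o ad y)%VF.

End LieAlgebras.

Definition dual (K : fieldType) (W : vectType K) (h : {vspace W}) :=
  'Hom(subvs_of h, K^o).

Section Tensor.
Context {K : fieldType}.

(* U (x) V is modelled as Hom(U^*, V), with u (x) v the map phi |-> phi(u) v. *)
Definition tensor (U V : vectType K) := 'Hom('Hom(U, K^o), V).

Definition tensv (U V : vectType K) (u : U) (v : V) : tensor U V :=
  linfun (fun phi : 'Hom(U, K^o) => (phi u : K) *: v).

Definition tensor_map (U V : vectType K) (a : 'End(U)) (b : 'End(V)) :
    'End(tensor U V) :=
  linfun (fun t : tensor U V =>
    (b \o t \o linfun (fun phi : 'Hom(U, K^o) => phi \o a))%VF).

Definition tensor_sub (U V : vectType K) (A : {vspace U}) (B : {vspace V}) :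
    {vspace tensor U V} :=
  <<[seq tensv u v | u <- vbasis A, v <- vbasis B]>>%VS.

Lemma tensvE (U V : vectType K) (u : U) (v : V) phi :
  tensv u v phi = (phi u : K) *: v.
Proof.
have fL : linear (fun phi : 'Hom(U, K^o) => (phi u : K) *: v).
  by move=> a p q; rewrite add_lfunE scale_lfunE scalerDl scalerA.
pose f : {linear 'Hom(U, K^o) -> V} :=
  HB.pack (fun phi : 'Hom(U, K^o) => (phi u : K) *: v)
    (GRing.isLinear.Build _ _ _ _ _ fL).
by rewrite /tensv -[fun _ => _]/(f : _ -> _) lfunE.
Qed.

Lemma tensor_mapE (U V : vectType K) (a : 'End(U)) (b : 'End(V)) t phi :
  tensor_map a b t phi = b (t (phi \o a)%VF).
Proof.
have fL : linear (fun phi : 'Hom(U, K^o) => (phi \o a)%VF).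
  by move=> c p q; rewrite comp_lfunDl -comp_lfunZl.
pose f : {linear 'Hom(U, K^o) -> 'Hom(U, K^o)} :=
  HB.pack (fun phi : 'Hom(U, K^o) => (phi \o a)%VF)
    (GRing.isLinear.Build _ _ _ _ _ fL).
have gL : linear (fun t : tensor U V => (b \o t \o linfun f)%VF).
  move=> c p q; apply/lfunP => z.
  by rewrite !(comp_lfunE, add_lfunE, scale_lfunE) linearP.
pose k : {linear tensor U V -> tensor U V} :=
  HB.pack (fun t : tensor U V => (b \o t \o linfun f)%VF)
    (GRing.isLinear.Build _ _ _ _ _ gL).
rewrite /tensor_map -[fun t : tensor U V => _]/(k : _ -> _) lfunE /=.
by rewrite !comp_lfunE -[fun phi : 'Hom(U, K^o) => _]/(f : _ -> _) lfunE.
Qed.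

Lemma tensor_map_tensv (U V : vectType K) (a : 'End(U)) (b : 'End(V)) u v :
  tensor_map a b (tensv u v) = tensv (a u) (b v).
Proof.
by apply/lfunP => phi; rewrite tensor_mapE !tensvE linearZ comp_lfunE.
Qed.

End Tensor.

Section Weights.
Context {K : fieldType} {g : lieAlgType K}.
Variable h : {vspace g}.
Implicit Types alpha beta nu : dual h.

(* Here rho : g -> End(W) is the Lie algebra action. *)
Definition weightspace (W : vectType K) (rho : g -> 'End(W)) nu : {vspace W} :=
  (\bigcap_(x <- vbasis h) lker (rho x - (nu (vsproj h x) : K) *: \1%VF))%VS.

Definition is_weight (W : vectType K) (rho : g -> 'End(W)) (M : {vspace W}) nu
  : bool := (M :&: weightspace rho nu)%VS != 0%VS.

Definition rootspace alpha : {vspace g} := weightspace ad alpha.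

Lemma rootspaceP alpha v :
  reflect (forall x : subvs_of h, lie (vsval x) v = (alpha x : K) *: v)
          (v \in rootspace alpha).
Proof.
have mem_cap (s : seq g) (F : g -> {vspace g}) :
    (v \in \bigcap_(x <- s) F x)%VS = all (fun x => v \in F x) s.
  elim: s => [|x s IHs]; first by rewrite big_nil memvf.
  by rewrite big_cons memv_cap IHs.
rewrite mem_cap; apply: (iffP allP) => [Hv x | Hv x /vbasis_mem hx]; last first.
  rewrite memv_ker add_lfunE opp_lfunE scale_lfunE id_lfunE adE subr_eq0.
  by rewrite -{1}(vsprojK hx) Hv.
rewrite -adE.
have {Hv} Hb y : y \in vbasis h -> ad y v = (alpha (vsproj h y) : K) *: v.
  move=> /Hv; rewrite memv_ker add_lfunE opp_lfunE scale_lfunE id_lfunE.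
  by rewrite subr_eq0 => /eqP.
rewrite -{2}[x]vsvalK (coord_vbasis (subvsP x)) !linear_sum /= sum_lfunE.
rewrite scaler_suml; apply: eq_bigr => i _.
rewrite !linearZ /= scale_lfunE Hb ?scalerA //.
by rewrite mem_nth ?size_tuple.
Qed.

Definition is_root alpha : bool := (alpha != 0) && (rootspace alpha != 0%VS).

Definition tensor_ad (x : g) : 'End(tensor g g) :=
  tensor_map (ad x) \1%VF + tensor_map \1%VF (ad x).

(* The form induced on h^* by the Killing form, transported along the map
   h -> h^*, x |-> killing(x, -), which is bijective for simple g. *)
Definition killing_flat : 'Hom(subvs_of h, dual h) :=
  linfun (fun x : subvs_of h =>
    linfun (fun y : subvs_of h => killing (vsval x) (vsval y) : K^o)).

Lemma killing_flatE (x y : subvs_of h) :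
  killing_flat x y = killing (vsval x) (vsval y).
Proof.
have trL : linear (fun f : 'End(g) => trace_end f : K^o).
  move=> a f f'; rewrite /trace_end scaler_sumr -big_split /=.
  by apply: eq_bigr => i _; rewrite add_lfunE scale_lfunE linearP.
have F2 (z : subvs_of h) :
    linear (fun y : subvs_of h => killing (vsval z) (vsval y) : K^o).
  by move=> a u w; rewrite /killing !linearP comp_lfunDr -comp_lfunZr trL.
pose f2 z : {linear subvs_of h -> K^o} :=
  HB.pack (fun y : subvs_of h => killing (vsval z) (vsval y) : K^o)
    (GRing.isLinear.Build _ _ _ _ _ (F2 z)).
have F1 : linear (fun z : subvs_of h => linfun (f2 z) : dual h).
  move=> a u w; apply/lfunP => z; rewrite add_lfunE scale_lfunE !lfunE /=.
  by rewrite /killing !linearP comp_lfunDl -comp_lfunZl trL.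
pose f1 : {linear subvs_of h -> dual h} :=
  HB.pack (fun z : subvs_of h => linfun (f2 z) : dual h)
    (GRing.isLinear.Build _ _ _ _ _ F1).
have -> : killing_flat = linfun f1 by [].
by rewrite lfunE; exact: (lfunE (f2 x) y).
Qed.

Definition form alpha beta : K := beta ((killing_flat^-1)%VF alpha).

Definition cartan_int alpha beta : K := 2 * form alpha beta / form beta beta.

End Weights.

Inductive dynkin :=
  | An of nat | Bn of nat | Cn of nat | Dn of nat
  | E6 | E7 | E8 | F4 | G2.

Definition rank (T : dynkin) : nat :=
  match T with
  | An n | Bn n | Cn n | Dn n => n
  | E6 => 6 | E7 => 7 | E8 => 8 | F4 => 4 | G2 => 2
  end.

Definition consecutive (i j : nat) : bool := (i.+1 == j) || (j.+1 == i).

(* Nodes are numbered from 1, as in Bourbaki. *)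
Definition dynkin_edge (T : dynkin) (i j : nat) : bool :=
  match T with
  | An _ | Bn _ | Cn _ | F4 | G2 => consecutive i j
  | Dn n => [|| [&& consecutive i j, i < n & j < n],
               (i.+2 == n) && (j == n) | (j.+2 == n) && (i == n)]%N
  | E6 | E7 | E8 => [&& consecutive i j, 3 <= i & 3 <= j]%N
      || ((i, j) \in [:: (1, 3); (3, 1); (2, 4); (4, 2)]%N)
  end.

(* n(alpha_i, alpha_j) = 2 (alpha_i, alpha_j) / (alpha_j, alpha_j) *)
Definition cartan_entry (T : dynkin) (i j : nat) : int :=
  if i == j then 2 else
  if ~~ dynkin_edge T i j then 0 else
  match T with
  | Bn n => if (i.+1 == n) && (j == n) then -2 else -1
  | Cn n => if (i == n) && (j.+1 == n) then -2 else -1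
  | F4 => if (i == 2)%N && (j == 3)%N then -2 else -1
  | G2 => if (i == 2)%N && (j == 1)%N then -3 else -1
  | _ => -1
  end.

Definition listed_type (T : dynkin) (i : nat) : bool :=
  match T with
  | Bn n => (3 <= i <= n)%N
  | Cn n => (2 <= i <= n.-1)%N
  | Dn n => (3 <= i <= n - 3)%N
  | E6 => (i == 3)%N || (i == 5)%N
  | E7 => (i == 2)%N || (i == 6)%N
  | E8 => (i == 1)%N
  | F4 => (i == 4)%N
  | _ => false
  end.

Section Parabolic.
Context {K : numClosedFieldType} {g : lieAlgType K}.
Variables (h : {vspace g}) (Delta : seq (dual h)).
Variables (n : nat) (Pi : n.-tuple (dual h)).
Implicit Types alpha lambda nu : dual h.

Definition root_base : Prop :=
  [/\ free Pi, {subset Pi <= Delta}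
    & {in Delta, forall alpha, exists c : 'I_n -> nat,
        let s := \sum_j (c j)%:R *: tnth Pi j in alpha = s \/ alpha = - s}].

(* On roots the coordinates are integers, so the order of K is meaningful. *)
Definition pos_root alpha : bool :=
  (alpha \in Delta) && [forall j, 0 <= coord Pi j alpha].

(* Delta(W) *)
Definition roots_of (W : {vspace g}) : seq (dual h) :=
  [seq alpha <- Delta | (rootspace alpha <= W)%VS].

Definition has_dynkin_type (T : dynkin) : Prop :=
  rank T = n /\
  forall i j : 'I_n,
    cartan_int (tnth Pi i) (tnth Pi j) = (cartan_entry T i.+1 j.+1)%:~R.

Section Maximal.
Variable q : 'I_n. (* alpha_q = tnth Pi q *)

Definition levi_root alpha : bool :=
  (alpha \in Delta) && (alpha \in <<[seq tnth Pi j | j <- enum 'I_n & j != q]>>%VS).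

Definition levi : {vspace g} :=
  (h + \sum_(alpha <- Delta | levi_root alpha) rootspace alpha)%VS.

Definition nilrad : {vspace g} :=
  (\sum_(alpha <- Delta | pos_root alpha && ~~ levi_root alpha)
     rootspace alpha)%VS.

Definition g1 : {vspace g} :=
  (\sum_(alpha <- Delta | coord Pi q alpha == 1) rootspace alpha)%VS.

Definition quasi_heisenberg : Prop :=
  bracketv nilrad (bracketv nilrad nilrad) = 0%VS /\
  (1 < \dim (bracketv nilrad nilrad))%N.

(* The order on weights of L-modules given by the simple roots of l. *)
Definition levi_le lambda nu : Prop :=
  exists c : 'I_n -> nat,
    nu - lambda = \sum_(j | j != q) (c j)%:R *: tnth Pi j.

Definition highest_weight (W : vectType K) (rho : g -> 'End(W))
    (M : {vspace W}) nu : Prop :=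
  is_weight rho M nu /\
  forall lambda, is_weight rho M lambda -> levi_le lambda nu.

Definition highest_root_of (W : {vspace g}) nu : Prop :=
  nu \in roots_of W /\ {in roots_of W, forall alpha, levi_le alpha nu}.

Local Open Scope classical_set_scope.

(* e = exp f; convergence is tested on coordinates *)
Definition is_expm (W : vectType K) (f e : 'End(W)) : Prop :=
  forall (v : W) (phi : 'Hom(W, K^o)),
    (fun N : nat => \sum_(k < N) (k`!%:R)^-1 * (phi (iter k f v) : K) : K)
      @ \oo --> (phi (e v) : K).

(* Ad(L), for the connected group L with Lie algebra l: the group generated
   by the exp(ad x), x in l. Inverses are provided by exp(ad (- x)). *)
Inductive Ad_L : 'End(g) -> Prop :=
  | Ad_L_id : Ad_L \1%VF
  | Ad_L_exp x e : x \in levi -> is_expm (ad x) e -> Ad_L e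
  | Ad_L_comp a b : Ad_L a -> Ad_L b -> Ad_L (a \o b)%VF.

Definition Ad_L_tensor (A : 'End(tensor g g)) : Prop :=
  exists2 a, Ad_L a & A = tensor_map a a.

Definition stable (W : vectType K) (G : 'End(W) -> Prop) (M : {vspace W}) :=
  forall a, G a -> (a @: M <= M)%VS.

Definition irreducible (W : vectType K) (G : 'End(W) -> Prop)
    (M : {vspace W}) : Prop :=
  [/\ M != 0%VS, stable G M
    & forall N : {vspace W}, (N <= M)%VS -> stable G N -> N = 0%VS \/ N = M].

(* V is an irreducible L-constituent V(nu) of A (x) B, for A, B in g. As L is
   reductive, constituents are submodules. *)
Definition constituent (A B : {vspace g}) (V : {vspace tensor g g}) nu
    : Prop :=
  [/\ (V <= tensor_sub A B)%VS, irreducible Ad_L_tensor V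
    & highest_weight (tensor_ad (g := g)) V nu].

(* V(nu) is special, mu and gamma being the highest weights of g(1), z(n). *)
Definition special (mu gamma nu : dual h) : Prop :=
  nu != gamma /\ exists2 eps, eps \in roots_of g1 & nu = mu + eps.

(* I is l_gamma *)
Definition l_gamma_spec (gamma : dual h) (I : {vspace g}) : Prop :=
  simple_ideal I (bracketv levi levi) /\
  exists2 j : 'I_n, forall k, (form gamma (tnth Pi k) != 0) = (k == j)
    & (rootspace (tnth Pi j) <= I)%VS.

End Maximal.
End Parabolic.

(* Main.v *)
From HB Require Import structures.
Require Import Defs.
From mathcomp Require Import all_boot all_order all_algebra.
From mathcomp Require Import complex reals boolp.

Set Implicit Arguments.
Unset Strict Implicit.
Unset Printing Implicit Defensive.

Import Order.TTheory GRing.Theory Num.Theory VectorInternalTheory.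

Local Open Scope ring_scope.

(** Suppose xi + gamma = mu + eps with eps a root of g(1). Comparing the
    coefficients of alpha_q shows that gamma has coefficient 2. Take root
    vectors e in g_gamma (central in n) and f in g_(-gamma) that are not
    Killing orthogonal, and let H = [e, f], which is a nonzero multiple of the
    coroot of gamma. If e kills g_beta and g_(gamma - beta), then e f f v = (2
    beta(H) - gamma(H)) f v is Killing orthogonal to g_(gamma - beta) for v in
    g_beta, so beta(H) is 0 or gamma(H)/2. This applies to mu and eps, since e
    is central, and to the simple root alpha_j not orthogonal to gamma, since
    gamma is highest; there alpha_j(H) <> 0. As xi - alpha_j is a nonnegative
    combination of simple roots, in units of gamma(H)/2 the value at H of xi +
    gamma is at least 3, whereas that of mu + eps is at most 2. No case
    analysis on the type is needed; the Cartan matrix only serves to show that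
    the Killing form is nonzero, hence nondegenerate as g is simple. *)

Section LinearAlgebra.
Context {K : fieldType}.

Lemma free_dual_basis (V : vectType K) n (X : n.-tuple 'Hom(V, K^o)) k :
  free X -> exists x : V, forall j, tnth X j x = (j == k)%:R.
Proof.
move=> freeX.
pose A := \matrix_(j < n, i < \dim {:V}) (tnth X j (vbasis {:V})`_i : K).
have freeA : row_free A.
  apply: inj_row_free => c cA0; apply/rowP => j; rewrite mxE.
  move/freeP: freeX => /(_ (fun j => c 0 j)); apply; apply/lfunP => v.
  rewrite sum_lfunE lfunE /=.
  rewrite (coord_vbasis (memvf v)).
  under eq_bigr => i _.
    rewrite scale_lfunE linear_sum /= scaler_sumr.
    under eq_bigr => l _ do rewrite linearZ /= scalerA mulrC -scalerA.
    over.
  rewrite exchange_big big1 //= => l _; rewrite -scaler_sumr.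
  have /rowP/(_ l) := cA0; rewrite !mxE => cA0l.
  rewrite [X in _ *: X](_ : _ = 0) ?scaler0 // -[RHS]cA0l.
  by apply: eq_bigr => i _; rewrite mxE (tnth_nth 0).
exists (\sum_i pinvmx A i k *: (vbasis {:V})`_i) => j.
rewrite linear_sum /=; have /matrixP/(_ j k) := mulmxVp freeA;
  rewrite !mxE => <-.
by apply: eq_bigr => i _; rewrite linearZ /= [A j i]mxE mulrC.
Qed.

Lemma lfun_f2mx (V W : vectType K) (f : 'Hom(V, W)) v :
  v2r (f v) = v2r v *m f2mx f.
Proof. by rewrite unlock /= r2vK. Qed.

Lemma inv_lfun0 (V W : vectType K) : (0 : 'Hom(V, W))^-1%VF = 0.
Proof.
apply/lfunP => v; apply: v2r_inj; rewrite lfun_f2mx /= lfunE /=.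
have -> : f2mx (0 : 'Hom(V, W)) = 0.
  apply/row_matrixP => i; rewrite row0 rowE -[delta_mx _ _]r2vK -lfun_f2mx.
  by rewrite zero_lfunE linear0.
by rewrite /pinvmx mxrank0 pid_mx_0 mulmx0 mul0mx mulmx0 linear0.
Qed.

End LinearAlgebra.

Section Trace.
Context {K : fieldType} {g : lieAlgType K}.

Lemma trace_endD (a b : 'End(g)) :
  trace_end (a + b) = trace_end a + trace_end b.
Proof.
by rewrite /trace_end -big_split; apply: eq_bigr => i _;
  rewrite add_lfunE linearD.
Qed.

Lemma trace_endZ c (a : 'End(g)) : trace_end (c *: a) = c * trace_end a.
Proof.
by rewrite /trace_end mulr_sumr; apply: eq_bigr => i _;
  rewrite scale_lfunE linearZ.
Qed.

Lemma trace_endB (a b : 'End(g)) :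
  trace_end (a - b) = trace_end a - trace_end b.
Proof. by rewrite trace_endD -scaleN1r trace_endZ mulN1r. Qed.

Lemma trace_endC (a b : 'End(g)) :
  trace_end (a \o b)%VF = trace_end (b \o a)%VF.
Proof.
have E (c d : 'End(g)) : trace_end (c \o d)%VF =
    \sum_(i < \dim {:g}) \sum_(k < \dim {:g})
      coord (vbasis {:g}) k (d (vbasis {:g})`_i) *
      coord (vbasis {:g}) i (c (vbasis {:g})`_k).
  apply: eq_bigr => i _; rewrite lfunE /=.
  rewrite {1}(coord_vbasis (memvf (d _))) !linear_sum.
  by apply: eq_bigr => k _; rewrite !linearZ.
rewrite !E exchange_big; apply: eq_bigr => i _; apply: eq_bigr => k _.
exact: mulrC.
Qed.

End Trace.

Section Killing.
Context {K : fieldType} {g : lieAlgType K}.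
Implicit Types x y z : g.

Lemma lieDl x y z : lie (x + y) z = lie x z + lie y z.
Proof. by rewrite -!adE linearD add_lfunE. Qed.

Lemma lieZl a x z : lie (a *: x) z = a *: lie x z.
Proof. by rewrite -!adE linearZ scale_lfunE. Qed.

Lemma lieC x y : lie x y = - lie y x.
Proof.
apply/eqP; rewrite -addr_eq0; have := liexx (x + y).
by rewrite lieDl -!adE !linearD /= !adE !liexx add0r addr0 => ->.
Qed.

Lemma lieNr x y : lie x (- y) = - lie x y.
Proof. by rewrite -!adE linearN. Qed.

Lemma lieZr a x z : lie x (a *: z) = a *: lie x z.
Proof. by rewrite -!adE linearZ. Qed.

Lemma lie0r x : lie x 0 = 0.
Proof. by rewrite -!adE linear0. Qed.

Lemma lie_derivation x y z :
  lie x (lie y z) = lie (lie x y) z + lie y (lie x z).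
Proof.
have /eqP := lie_jacobi x y z; rewrite -addrA addr_eq0 => /eqP ->.
by rewrite (lieC z (lie x y)) (lieC z x) lieNr opprD !opprK addrC.
Qed.

Lemma killingC x y : killing x y = killing y x.
Proof. exact: trace_endC. Qed.

Lemma killingDl x y z : killing (x + y) z = killing x z + killing y z.
Proof. by rewrite /killing linearD comp_lfunDl trace_endD. Qed.

Lemma killingZl a x z : killing (a *: x) z = a * killing x z.
Proof. by rewrite /killing linearZ -comp_lfunZl trace_endZ. Qed.

Lemma killingDr x y z : killing x (y + z) = killing x y + killing x z.
Proof. by rewrite killingC killingDl !(killingC x). Qed.

Lemma killingZr a x z : killing x (a *: z) = a * killing x z.
Proof. by rewrite killingC killingZl killingC. Qed.

Lemma killingNl x z : killing (- x) z = - killing x z.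
Proof. by rewrite -scaleN1r killingZl mulN1r. Qed.

Lemma killing_invariant x y z : killing (lie x y) z = killing x (lie y z).
Proof.
have adM (u v : g) : ad (lie u v) = (ad u \o ad v)%VF - (ad v \o ad u)%VF.
  apply/lfunP => w; rewrite add_lfunE opp_lfunE !comp_lfunE !adE.
  by rewrite lie_derivation addrK.
rewrite /killing !adM.
rewrite comp_lfunDl comp_lfunDr comp_lfunNl comp_lfunNr !trace_endB.
by rewrite !comp_lfunA -(comp_lfunA (ad y)) (trace_endC (ad y)).
Qed.

Lemma killing_nondegenerate : simple_subalg {:g}%VS ->
  ~ (forall x y, killing x y = 0) ->
  forall x, (forall y, killing x y = 0) -> x = 0.
Proof.
move=> [_ _ simp] nz.
have linr y : linear (fun x => killing x y : K^o).
  by move=> a u v; rewrite killingDl killingZl.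
pose phi y : {linear g -> K^o} := HB.pack (fun x => killing x y : K^o)
  (GRing.isLinear.Build _ _ _ _ _ (linr y)).
pose Rad := (\bigcap_(y <- vbasis {:g}) lker (linfun (phi y)))%VS.
have RadP x : reflect (forall y, killing x y = 0) (x \in Rad).
  have mem_cap (s : seq g) :
      (x \in \bigcap_(y <- s) lker (linfun (phi y)))%VS
      = all (fun y => killing x y == 0) s.
    elim: s => [|y s IHs]; first by rewrite big_nil memvf.
    by rewrite big_cons memv_cap IHs memv_ker lfunE.
  rewrite mem_cap; apply: (iffP allP) => [H y | H y _]; last by rewrite H.
  rewrite (coord_vbasis (memvf y)) killingC.
  apply: (big_ind (fun y => killing y x = 0)) => [|u v Hu Hv|i _].
  - by rewrite -(scale0r x) killingZl mul0r.
  - by rewrite killingDl Hu Hv addr0.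
  - by rewrite killingZl killingC (eqP (H _ _)) ?mulr0 // mem_nth ?size_tuple.
have RadI : ideal_of Rad {:g}%VS.
  apply/andP; split; first exact: subvf.
  apply/span_subvP => _ /allpairsP[[u v] /= [_ /vbasis_mem/RadP vR ->]].
  apply/RadP => y; rewrite lieC killingNl killing_invariant vR oppr0.
  by [].
move=> x /RadP; case: (simp _ RadI) => [->|E]; first by rewrite memv0 => /eqP.
by case: nz => x0; apply/RadP; rewrite E memvf.
Qed.

End Killing.

Section WeightVectors.
Context {K : fieldType} {g : lieAlgType K} {h : {vspace g}}.
Implicit Types (x y v w : g) (nu : dual h).

Lemma rootspace_lie (nu : dual h) v z :
  v \in rootspace nu -> z \in h -> lie z v = (nu (vsproj h z) : K) *: v.
Proof. by move=> /rootspaceP + hz => /(_ (vsproj h z)); rewrite vsprojK. Qed.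

Lemma lie_rootspace (a b : dual h) v w :
  v \in rootspace a -> w \in rootspace b -> lie v w \in rootspace (a + b).
Proof.
move=> /rootspaceP av /rootspaceP bw; apply/rootspaceP => z.
rewrite lie_derivation av bw lieZl lieZr add_lfunE.
by rewrite scalerDl.
Qed.

Lemma eigenvector_weight v :
  (forall x, x \in vbasis h -> exists a, lie x v = a *: v) ->
  exists nu : dual h, v \in rootspace nu.
Proof.
move=> Hv; have [->|v0] := eqVneq v 0; first by exists 0; rewrite mem0v.
have hv z : z \in h -> lie z v \in <[v]>%VS.
  move=> hz; rewrite (coord_vbasis hz) lieC memvN -adE linear_sum.
  apply: memv_suml => i _; rewrite linearZ memvZ //= adE lieC memvN.
  have [|a ->] := Hv (vbasis h)`_i; first by rewrite mem_nth ?size_tuple.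
  by rewrite memvZ ?memv_line.
have fv : free [tuple v] by rewrite free_cons nil_free andbT span_nil memv0.
have linr : linear
    (fun z : subvs_of h => coord [tuple v] ord0 (lie (vsval z) v) : K^o).
  by move=> a x y; rewrite linearP lieDl lieZl linearP.
pose phi : {linear subvs_of h -> K^o} :=
  HB.pack (fun z : subvs_of h => coord [tuple v] ord0 (lie (vsval z) v) : K^o)
  (GRing.isLinear.Build _ _ _ _ _ linr).
exists (linfun phi); apply/rootspaceP => z; rewrite lfunE /=.
have /vlineP[a ->] := hv _ (subvsP z); rewrite linearZ /=.
by have := coord_free ord0 ord0 fv; rewrite /= => ->; rewrite mulr1.
Qed.

Lemma diagonalizable_endP (f : 'End(g)) :
  diagonalizable_end f -> diagonalizable (f2mx f).
Proof.
move=> [b b_basis fb]; apply/codiagonalizable1/codiagonalizablePfull.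
pose X := in_tuple b; have freeb : row_free (b2mx X).
  apply: inj_row_free => c cX0; apply/rowP => i; rewrite mxE.
  have /(freeP (X := X))/(_ (fun i => c 0 i)) := basis_free b_basis; apply.
  apply: v2r_inj; rewrite linear0 -[RHS]cX0 mulmx_sum_row linear_sum.
  by apply: eq_bigr => j _; rewrite linearZ rowK (tnth_nth 0).
exists (size b), (b2mx X).
  rewrite -col_leq_rank (eqP freeb).
  by rewrite -[X in (X <= _)%N]dimvf (size_basis (X := X) b_basis).
have /fin_all_exists[d dP] (i : 'I_(size b)) : exists a : K, f b`_i = a *: b`_i.
  by apply: fb; rewrite mem_nth.
rewrite /= andbT; apply/diagonalizable_forPex; exists (\row_i d i).
apply: simmxW => //.
apply/row_matrixP => i; rewrite !row_mul row_diag_mx mxE -scalemxAl -rowE.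
by rewrite !rowK (tnth_nth 0) /= -lfun_f2mx dP linearZ.
Qed.

Lemma weight_vectors_span (U : {vspace g}) : cartan_subalgebra h ->
  (forall nu v, v \in rootspace (h := h) nu -> v \in U) -> U = fullv.
Proof.
move=> [h_ab _ h_diag] HU.
pose As := [seq f2mx (ad x) | x <- vbasis h].
have /codiagonalizableP[P Pu /allP PA] :
    {in As &, forall A B, comm_mx A B} /\ {in As, forall A, diagonalizable A}.
  split=> [_ _ /mapP[x /vbasis_mem hx ->] /mapP[y /vbasis_mem hy ->]|].
    apply/row_matrixP => i; rewrite !rowE -[delta_mx _ _]r2vK !mulmxA.
    rewrite -!lfun_f2mx !adE lie_derivation (h_ab y x) // lieC lie0r oppr0.
    by rewrite add0r.
  by move=> _ /mapP[x /vbasis_mem hx ->]; apply/diagonalizable_endP/h_diag.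
apply/vspaceP => v; rewrite memvf -[v]v2rK -[v2r v](mulmxKV Pu).
set c := v2r v *m _; rewrite mulmx_sum_row linear_sum memv_suml // => i _.
rewrite linearZ memvZ //=.
have [x hx|nu] := @eigenvector_weight (r2v (row i P)); last exact: HU.
have /PA /= : f2mx (ad x) \in As by apply: map_f.
move=> /diagonalizable_forPex[D /simmxPp].
rewrite stablemx_unit // => /(_ isT) /(congr1 (row i)).
rewrite !row_mul row_diag_mx -scalemxAl -rowE => E; exists (D 0 i).
by apply: v2r_inj; rewrite -adE lfun_f2mx r2vK E linearZ /= r2vK.
Qed.

End WeightVectors.

Section KillingWeights.
Context {K : fieldType} {g : lieAlgType K} {h : {vspace g}}.
Implicit Types (a b gamma : dual h) (v w e f : g).

Lemma killing_rootspace a b v w :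
  v \in rootspace a -> w \in rootspace b -> a + b != 0 -> killing v w = 0.
Proof.
move=> /rootspaceP av /rootspaceP bw; apply: contra_neq_eq => nz.
apply/lfunP => z; rewrite add_lfunE zero_lfunE; apply: (mulIf nz).
rewrite mul0r mulrDl -killingZl -killingZr -av -bw.
by rewrite lieC killingNl killing_invariant addNr.
Qed.

Lemma form_neq0_killing a b : Defs.form a b != 0 ->
  ~ (forall v w, killing v w = 0 :> K).
Proof.
move=> /eqP ab kill0; apply: ab; rewrite /Defs.form.
have -> : killing_flat h = 0.
  by apply/lfunP => z; apply/lfunP => y;
    rewrite killing_flatE kill0 !zero_lfunE.
by rewrite inv_lfun0 zero_lfunE linear0.
Qed.

Hypothesis h_cartan : cartan_subalgebra h.
Hypothesis killing_nondeg : forall v, (forall w, killing v w = 0 :> K) -> v = 0.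

Lemma mem_rootspace0 v : (v \in rootspace (0 : dual h)) = (v \in h).
Proof.
have [h_ab h_max _] := h_cartan; apply/idP/idP => [/rootspaceP v0|hv].
  apply: h_max => z hz; have := v0 (vsproj h z).
  by rewrite vsprojK // zero_lfunE scale0r lieC => /eqP;
    rewrite oppr_eq0 => /eqP.
by apply/rootspaceP => z; rewrite h_ab ?subvsP // zero_lfunE scale0r.
Qed.

Lemma killing_rootspace_nondeg a v : v \in rootspace a ->
  (forall w, w \in rootspace (- a) -> killing v w = 0) -> v = 0.
Proof.
move=> av v0; apply: killing_nondeg => w.
have lin : linear (fun w => killing v w : K^o).
  by move=> c x y; rewrite killingDr killingZr.
pose phi : {linear g -> K^o} := HB.pack (fun w => killing v w : K^o)
  (GRing.isLinear.Build _ _ _ _ _ lin).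
have phi_full : lker (linfun phi) = fullv.
  apply: (weight_vectors_span h_cartan) => b u bu; rewrite memv_ker lfunE /=.
  have [ab0|ab] := eqVneq (a + b) 0;
    last by rewrite (killing_rootspace av bu ab).
  by rewrite v0 // (_ : - a = b) //; apply/eqP;
    rewrite eq_sym -addr_eq0 addrC ab0.
have : w \in lker (linfun phi) by rewrite phi_full memvf.
by rewrite memv_ker lfunE => /eqP.
Qed.

Lemma killing_flat_inj : lker (killing_flat h) == 0%VS.
Proof.
apply/eqP/vspaceP => z; rewrite memv0 memv_ker; apply/eqP/eqP => [z0|->];
  last by rewrite linear0.
apply: val_inj; apply: (@killing_rootspace_nondeg 0).
  by rewrite mem_rootspace0 subvsP.
move=> w; rewrite oppr0 mem_rootspace0 => hw.
by rewrite -[w in killing _ w](vsprojK hw) -killing_flatE z0 zero_lfunE.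
Qed.

Lemma lie_rootspace_opp gamma e f :
  e \in rootspace gamma -> f \in rootspace (- gamma) -> lie e f \in h.
Proof.
by move=> he hf; rewrite -mem_rootspace0 -(subrr gamma) lie_rootspace.
Qed.

Lemma form_killing gamma b e f :
  e \in rootspace gamma -> f \in rootspace (- gamma) ->
  killing e f * Defs.form gamma b = b (vsproj h (lie e f)).
Proof.
move=> he hf; have hH := lie_rootspace_opp he hf.
have flatH : killing_flat h (vsproj h (lie e f)) = killing e f *: gamma.
  apply/lfunP => z; rewrite killing_flatE vsprojK // scale_lfunE.
  rewrite killing_invariant lieC (rootspace_lie hf (subvsP z)) vsvalK.
  by rewrite opp_lfunE scaleNr opprK killingZr mulrC.
rewrite -[X in b X](lker0_lfunK killing_flat_inj) flatH !linearZ.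
by [].
Qed.

Lemma coroot_value gamma b e f v :
    e \in rootspace gamma -> f \in rootspace (- gamma) ->
    v \in rootspace b -> v != 0 -> lie e v = 0 ->
    (forall w, w \in rootspace (gamma - b) -> lie e w = 0) ->
  let H := vsproj h (lie e f) in b H = 0 \/ (b H : K) *+ 2 = gamma H.
Proof.
move=> he hf bv v0 ev ew H; have hH := lie_rootspace_opp he hf.
pose u := lie f v; have bu : u \in rootspace (- gamma + b) by exact:
  lie_rootspace.
have eu : lie e u = (b H : K) *: v.
  by rewrite lie_derivation ev lie0r addr0 (rootspace_lie bv hH).
have efu : lie e (lie f u) = ((b H : K) *+ 2 - gamma H) *: u.
  rewrite lie_derivation (rootspace_lie bu hH) eu lieZr -scalerDl;
    congr (_ *: _).
  by rewrite add_lfunE opp_lfunE mulr2n -/H addrAC addrC -addrA [_ + b H]addrC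
    addrA.
have [p2|np2] := eqVneq ((b H : K) *+ 2) (gamma H); [by right|left].
suff u0 : u = 0.
  by move/eqP: eu; rewrite u0 lie0r eq_sym scaler_eq0 (negPf v0) orbF => /eqP.
apply: (killing_rootspace_nondeg bu) => w; rewrite opprD opprK => bw.
move: np2; rewrite -subr_eq0 => /mulfI; apply; rewrite mulr0 -killingZl -efu.
by rewrite lieC killingNl killing_invariant ew // -(scale0r 0) killingZr mul0r
  oppr0.
Qed.

End KillingWeights.

Lemma subv_sum_seq (K : fieldType) (W : vectType K) (I : eqType) (r : seq I)
    (P : pred I) (F : I -> {vspace W}) (U : {vspace W}) :
  (forall i, i \in r -> P i -> (F i <= U)%VS) ->
  (\sum_(i <- r | P i) F i <= U)%VS.
Proof.
move=> FU; rewrite big_seq_cond.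
apply: (big_ind (fun V : {vspace W} => (V <= U)%VS)) => [|V V' HV HV'|i].
- exact: sub0v.
- by rewrite subv_add HV.
- by case/andP; exact: FU.
Qed.

Lemma sumv_sup_seq (K : fieldType) (W : vectType K) (I : eqType) (r : seq I)
    (P : pred I) (F : I -> {vspace W}) i :
  i \in r -> P i -> (F i <= \sum_(j <- r | P j) F j)%VS.
Proof. by move=> ri Pi; rewrite (big_rem i) //= Pi addvSl. Qed.

Lemma centervP (K : fieldType) (g : lieAlgType K) (U : {vspace g}) v :
  reflect (v \in U /\ {in U, forall u, lie u v = 0}) (v \in centerv U).
Proof.
rewrite memv_cap.
have -> : (v \in \bigcap_(x <- vbasis U) lker (ad x))%VS
    = all (fun x => lie x v == 0) (vbasis U).
  elim: (tval _) => [|x s IHs]; first by rewrite big_nil memvf.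
  by rewrite big_cons memv_cap IHs memv_ker adE.
apply: (iffP andP) => -[Uv H]; split=> //.
  move=> u /coord_vbasis ->; rewrite lieC -adE linear_sum big1 ?oppr0 // => i _.
  rewrite linearZ /= adE lieC.
  by rewrite (eqP (allP H _ _)) ?mem_nth ?size_tuple // oppr0 scaler0.
by apply/allP => u /vbasis_mem /H ->.
Qed.

Lemma is_weightP (K : fieldType) (g : lieAlgType K) (h : {vspace g})
    (M : {vspace g}) (nu : dual h) :
  is_weight ad M nu <-> exists2 v, v \in M & v \in rootspace nu /\ v != 0.
Proof.
split=> [w | [v Mv [nv]]].
  exists (vpick (M :&: rootspace nu)%VS); last split.
  - by apply: subvP (memv_pick _); exact: capvSl.
  - by apply: subvP (memv_pick _); exact: capvSr.
  - by rewrite vpick0.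
by apply: contraNneq => E; rewrite -memv0 -E memv_cap Mv.
Qed.

Section Grading.
Context {K : numClosedFieldType} {g : lieAlgType K} {h : {vspace g}}.
Variables (Delta : seq (dual h)) (n : nat) (Pi : n.-tuple (dual h)) (q : 'I_n).
Hypotheses (DeltaP : Delta =i is_root (h := h)) (Pi_base : root_base Delta Pi).
Variable x : subvs_of h.
Hypothesis xP : forall j, tnth Pi j x = (j == q)%:R.
Implicit Types (alpha : dual h) (v w : g).

Lemma grade_sum (c : 'I_n -> nat) : (\sum_j (c j)%:R *: tnth Pi j) x = (c q)%:R.
Proof.
rewrite sum_lfunE (bigD1 q) //= big1 => [|j /negPf jq].
  by rewrite addr0 scale_lfunE xP eqxx /GRing.scale /= mulr1.
by rewrite scale_lfunE xP jq scaler0.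
Qed.

Lemma grade_levi_sum (c : 'I_n -> nat) :
  (\sum_(j | j != q) (c j)%:R *: tnth Pi j) x = 0.
Proof.
rewrite sum_lfunE big1 // => j /negPf jq.
by rewrite scale_lfunE xP jq scaler0.
Qed.

Lemma root_mem_span alpha : alpha \in Delta -> alpha \in <<Pi>>%VS.
Proof.
have [_ _ base] := Pi_base => /base[c /= cP].
have sP : \sum_j (c j)%:R *: tnth Pi j \in <<Pi>>%VS.
  by apply: memv_suml => j _; rewrite memvZ ?memv_span ?mem_tnth.
by case: cP => ->; rewrite ?memvN.
Qed.

Lemma grade_coord alpha : alpha \in Delta -> alpha x = coord Pi q alpha.
Proof.
move=> /root_mem_span/coord_span {1}->; rewrite sum_lfunE (bigD1 q) //= big1.
  by rewrite addr0 scale_lfunE -tnth_nth xP eqxx /GRing.scale /= mulr1.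
by move=> j /negPf jq; rewrite scale_lfunE -tnth_nth xP jq scaler0.
Qed.

Lemma grade_levi_root alpha : levi_root Delta Pi q alpha -> alpha x = 0.
Proof.
move=> /andP[_ /(coord_span (X := in_tuple _)) ->];
  rewrite sum_lfunE big1 // => i _.
have : [seq tnth Pi j | j <- enum 'I_n & j != q]`_i
    \in [seq tnth Pi j | j <- enum 'I_n & j != q] by rewrite mem_nth.
case/mapP => j; rewrite mem_filter => /andP[/negPf jq _].
by rewrite scale_lfunE => ->; rewrite xP jq scaler0.
Qed.

Lemma root_coord_sum (c : 'I_n -> nat) j :
  coord Pi j (\sum_k (c k)%:R *: tnth Pi k) = (c j)%:R.
Proof.
have [fPi _ _] := Pi_base.
under eq_bigr => k _ do rewrite (tnth_nth 0).
exact: coord_sum_free.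
Qed.

Lemma rootspace_nilrad alpha k v :
  alpha x = k.+1%:R :> K -> v \in rootspace alpha -> v \in nilrad Delta Pi q.
Proof.
move=> ax av; have [->|v0] := eqVneq v 0; first exact: mem0v.
have a0 : alpha != 0.
  by apply: contra_eq_neq ax => ->; rewrite zero_lfunE eq_sym pnatr_eq0.
have Da : alpha \in Delta.
  rewrite DeltaP; apply/andP; split=> //; apply: contraNneq v0 => E.
  by rewrite -memv0 -E.
apply: (subvP (sumv_sup_seq _ Da _)) av.
rewrite /pos_root Da /=; apply/andP; split; last first.
  by apply/negP => /grade_levi_root /eqP; rewrite ax pnatr_eq0.
have [_ _ /(_ _ Da)[c /= [E|E]]] := Pi_base; apply/forallP => j.
  by rewrite E root_coord_sum ler0n.
move/eqP: ax; rewrite E opp_lfunE grade_sum eq_sym -subr_eq0 opprK -natrD.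
by rewrite pnatr_eq0.
Qed.

Lemma nilrad_root_grade alpha :
  pos_root Delta Pi alpha && ~~ levi_root Delta Pi q alpha ->
  exists k, alpha x = k.+1%:R :> K.
Proof.
move=> /andP[/andP[Da /forallP pos] nl].
have [fPi _ /(_ _ Da)[c /= cP]] := Pi_base.
have : (c q)%:R != 0 :> K.
  apply: contra nl => /eqP cq0; rewrite /levi_root Da /=.
  have sP : \sum_j (c j)%:R *: tnth Pi j
      \in <<[seq tnth Pi j | j <- enum 'I_n & j != q]>>%VS.
    rewrite (bigD1 q) //= cq0 scale0r add0r memv_suml // => j jq.
    by rewrite memvZ ?memv_span // map_f // mem_filter jq mem_enum.
  by case: cP => ->; rewrite ?memvN.
rewrite pnatr_eq0; case cqE: (c q) => [//|k] _.
case: cP => E; first by exists k; rewrite E grade_sum cqE.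
have := pos q; rewrite E linearN /= root_coord_sum cqE oppr_ge0.
by rewrite lern0.
Qed.

Lemma nilrad_grade0_stable alpha v w : alpha x = 0 ->
  v \in rootspace alpha -> w \in nilrad Delta Pi q ->
  lie v w \in nilrad Delta Pi q.
Proof.
move=> ax av nw; rewrite -adE memv_preim; apply: subvP nw.
apply: subv_sum_seq => b _ /nilrad_root_grade[k bx]; apply/subvP => u bu.
rewrite -memv_preim adE; apply: (@rootspace_nilrad (alpha + b) k).
  by rewrite add_lfunE ax add0r.
exact: lie_rootspace.
Qed.

Lemma g1_grade v : v \in g1 Delta Pi q -> lie (vsval x) v = v.
Proof.
move=> gv; have : v \in lker (ad (vsval x) - \1%VF).
  apply: subvP gv; apply: subv_sum_seq => a Da /eqP a1;
    apply/subvP => u /rootspaceP au.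
  by rewrite memv_ker add_lfunE opp_lfunE id_lfunE adE au grade_coord // a1
    scale1r subrr.
by rewrite memv_ker add_lfunE opp_lfunE id_lfunE adE subr_eq0 => /eqP.
Qed.

Lemma weight_grade nu v : v \in rootspace nu -> v != 0 -> forall c,
  lie (vsval x) v = c *: v -> nu x = c.
Proof.
move=> /rootspaceP nv v0 c; rewrite nv => /eqP.
by rewrite -subr_eq0 -scalerBl scaler_eq0 (negPf v0) orbF subr_eq0 => /eqP.
Qed.

Lemma levi_grade v : {in h &, forall y z, lie y z = 0} ->
  v \in levi Delta Pi q -> lie (vsval x) v = 0.
Proof.
move=> h_ab lv; apply/eqP; rewrite -adE -memv_ker; apply: subvP lv.
rewrite subv_add; apply/andP; split.
  by apply/subvP => z hz; rewrite memv_ker adE h_ab ?subvsP.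
apply: subv_sum_seq => a _ /grade_levi_root ax; apply/subvP => u /rootspaceP au.
by rewrite memv_ker adE au ax scale0r.
Qed.

Lemma levi_derived_grade v : {in h &, forall y z, lie y z = 0} ->
  v \in bracketv (levi Delta Pi q) (levi Delta Pi q) -> lie (vsval x) v = 0.
Proof.
move=> h_ab lv; apply/eqP; rewrite -adE -memv_ker; apply: subvP lv.
apply/span_subvP => _ /allpairsP[[u w] /= [/vbasis_mem lu /vbasis_mem lw ->]].
by rewrite memv_ker adE lie_derivation !levi_grade // lieC !lie0r oppr0 addr0.
Qed.

Lemma centerv_nilrad_stable alpha v e : alpha x = 0 -> v \in rootspace alpha ->
  e \in centerv (nilrad Delta Pi q) -> lie v e \in centerv (nilrad Delta Pi q).
Proof.
move=> ax av /centervP[ne ce].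
have nv y : y \in nilrad Delta Pi q -> lie v y \in nilrad Delta Pi q.
  exact: nilrad_grade0_stable ax av.
apply/centervP; split=> [|y ny]; first exact: nv.
by rewrite lie_derivation (ce y) // lie0r addr0 ce // lieC memvN nv.
Qed.

Lemma highest_weight_lie0 gamma j v e :
    highest_weight Pi q ad (centerv (nilrad Delta Pi q)) gamma ->
    e \in centerv (nilrad Delta Pi q) -> e \in rootspace gamma -> j != q ->
    v \in rootspace (tnth Pi j) ->
  lie v e = 0.
Proof.
move=> [_ gamma_max] ze he jq av; apply/eqP/negPn/negP => nz.
have [|d dP] := gamma_max (tnth Pi j + gamma).
  apply: (is_weightP _ _).2; exists (lie v e).
    by apply: centerv_nilrad_stable av ze; rewrite xP (negPf jq).
  by split; first exact: (lie_rootspace av he).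
have [fPi _ _] := Pi_base; have [y yP] := free_dual_basis j fPi.
move: dP; rewrite opprD addrCA subrr addr0 => /lfunP/(_ y).
rewrite opp_lfunE sum_lfunE (bigD1 j) //= big1.
  rewrite scale_lfunE yP eqxx addr0 => /eqP.
  by rewrite eq_sym -addr_eq0 /GRing.scale /= mulr1 natr1 pnatr_eq0.
by move=> k /andP[_ /negPf kj]; rewrite scale_lfunE yP kj scaler0.
Qed.

End Grading.

Lemma highest_roots_sum_not_special (K : numClosedFieldType) (g : lieAlgType K)
    (h : {vspace g}) (Delta : seq (dual h)) (n : nat) (Pi : n.-tuple (dual h))
    (T : dynkin) (q : 'I_n) (mu gamma xi : dual h) (lgamma : {vspace g}) :
  simple_subalg {:g}%VS -> cartan_subalgebra h ->
  Delta =i is_root (h := h) -> root_base Delta Pi -> has_dynkin_type Pi T ->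
  highest_weight Pi q ad (g1 Delta Pi q) mu ->
  highest_weight Pi q ad (centerv (nilrad Delta Pi q)) gamma ->
  l_gamma_spec Delta Pi q gamma lgamma ->
  highest_root_of Delta Pi q lgamma xi ->
  ~ special Delta Pi q mu gamma (xi + gamma).
Proof.
move=> g_simple h_cartan DeltaP Pi_base T_type mu_hw gamma_hw lgammaP xi_hr.
move=> [_ [eps eps_g1 sumE]].
have [h_ab _ _] := h_cartan; have [fPi Pi_Delta _] := Pi_base.
have [x xP] := free_dual_basis q fPi.
have killing_nondeg (v : g) : (forall w, killing v w = 0) -> v = 0.
  apply: killing_nondegenerate g_simple _ v.
  apply: (@form_neq0_killing _ _ h (tnth Pi q) (tnth Pi q)).
  have := T_type.2 q q; rewrite /cartan_int /cartan_entry eqxx => cqq.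
  apply: contra_eq_neq cqq => ->; rewrite mulr0 mul0r eq_sym.
  by rewrite intr_eq0.
have root_vector (a : dual h) : a \in Delta ->
    exists2 v, v \in rootspace a & v != 0.
  rewrite DeltaP => /andP[_ a0]; exists (vpick (rootspace a)).
    exact: memv_pick.
  by rewrite vpick0.
have [[/andP[lg_l _] _] [j jP j_lg]] := lgammaP.
have [v av v0] := root_vector _ (Pi_Delta _ (mem_tnth j Pi)).
have ajx : tnth Pi j x = 0.
  apply: (weight_grade av v0); rewrite scale0r.
  apply: (levi_derived_grade xP h_ab).
  by apply: subvP lg_l _ _; apply: subvP j_lg _ _.
have jq : j != q.
  by apply: contra_eq_neq ajx => ->; rewrite xP eqxx oner_eq0.
have [c xiE] : levi_le Pi q (tnth Pi j) xi.
  by apply: xi_hr.2; rewrite mem_filter j_lg Pi_Delta ?mem_tnth.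
move/eqP: xiE; rewrite subr_eq => /eqP xiE.
have xix : xi x = 0 by rewrite xiE add_lfunE ajx (grade_levi_sum xP) addr0.
have [u gu [mu_u u0]] := (is_weightP _ _).1 mu_hw.1.
have mux : mu x = 1.
  by apply: (weight_grade mu_u u0); rewrite (g1_grade Pi_base xP gu) scale1r.
have [epsD eps_sub] : eps \in Delta /\ (rootspace eps <= g1 Delta Pi q)%VS.
  by move: eps_g1; rewrite mem_filter => /andP[].
have [w eps_w w0] := root_vector _ epsD.
have epsx : eps x = 1.
  apply: (weight_grade eps_w w0).
  by rewrite (g1_grade Pi_base xP) ?scale1r //; exact: subvP eps_sub _ _.
have gammax : gamma x = 2%:R :> K.
  move/lfunP: sumE => /(_ x); rewrite !add_lfunE xix mux epsx add0r => ->.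
  by rewrite -natr1.
have [e ze [he e0]] := (is_weightP _ _).1 gamma_hw.1.
have [ne ce] := centervP _ _ ze.
have en y : y \in nilrad Delta Pi q -> lie e y = 0.
  by move=> /ce ey; rewrite lieC ey oppr0.
have eaj : lie e v = 0.
  by rewrite lieC (highest_weight_lie0 DeltaP Pi_base xP gamma_hw ze he jq av)
    oppr0.
have [f hf ef] : exists2 f, f \in rootspace (- gamma) & killing e f != 0.
  apply: contrapT => nf; case/eqP: e0.
  apply: (killing_rootspace_nondeg h_cartan killing_nondeg he) => y hy.
  by apply/eqP; apply: contraT => ey; case: nf; exists y.
pose H := vsproj h (lie e f).
have formE b := form_killing h_cartan killing_nondeg b he hf.
have cv b y := @coroot_value _ _ _ h_cartan killing_nondeg gamma b e f y he hf.
have akH k : (tnth Pi k H != 0) = (k == j).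
  by rewrite -formE mulf_eq0 (negPf ef) /= jP.
pose a : K := tnth Pi j H.
have a0 : a != 0 by rewrite akH.
have gammaH : a *+ 2 = gamma H.
  case: (cv _ _ av v0 eaj) => // [y hy|ajH]; last by case/eqP: a0.
  apply/en/(rootspace_nilrad DeltaP Pi_base xP _ hy (k := 1)).
  by rewrite add_lfunE opp_lfunE ajx subr0 gammax.
have grade1 (b : dual h) y : b x = 1 -> y \in rootspace b -> y != 0 ->
    exists s : bool, b H = a *+ s.
  move=> bx hy y0.
  have n1 z (b' : dual h) : b' x = 1 -> z \in rootspace b' -> lie e z = 0.
    by move=> b'x hz; apply/en/(rootspace_nilrad DeltaP Pi_base xP _ hz (k :=
      0)).
  case: (cv _ _ hy y0) => [|z|bH|bH].
  - exact: n1 hy.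
  - by apply: n1; rewrite add_lfunE opp_lfunE gammax bx -natr1 addrK.
  - by exists false.
  - exists true; move: bH; rewrite -gammaH -(mulr_natr _ 2) -(mulr_natr a 2).
    by move/mulIf => -> //; rewrite pnatr_eq0.
have [s1 muH] := grade1 _ _ mux mu_u u0.
have [s2 epsH] := grade1 _ _ epsx eps_w w0.
have xiH : xi H = a *+ (c j).+1.
  rewrite xiE add_lfunE sum_lfunE (bigD1 j) //= big1 => [|k /andP[_ kj]].
    by rewrite scale_lfunE addr0 mulrSr /GRing.scale /= mulr_natl.
  rewrite scale_lfunE; apply/eqP; rewrite scaler_eq0.
  by rewrite -[_ == 0 in X in _ || X]negbK akH kj orbT.
move/lfunP: sumE => /(_ H); rewrite !add_lfunE xiH -gammaH muH epsH.
rewrite -!mulrnDr => /(mulrIn a0).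
by rewrite addn2; case: s1 {muH}; case: s2 {epsH}.
Qed.

Theorem lemma6p10 (R : realType) (g : lieAlgType R[i])
    (g_simple : simple_subalg {:g}%VS)
    (h : {vspace g}) (h_cartan : cartan_subalgebra h)
    (Delta : seq (dual h)) (DeltaP : Delta =i is_root (h := h))
    (n : nat) (Pi : n.-tuple (dual h)) (Pi_base : root_base Delta Pi)
    (T : dynkin) (T_type : has_dynkin_type Pi T)
    (q : 'I_n) (q_listed : listed_type T q.+1)
    (q_qH : quasi_heisenberg Delta Pi q)
    (mu gamma xi : dual h)
    (mu_hw : highest_weight Pi q ad (g1 Delta Pi q) mu)
    (gamma_hw : highest_weight Pi q ad (centerv (nilrad Delta Pi q)) gamma)
    (lgamma : {vspace g}) (lgammaP : l_gamma_spec Delta Pi q gamma lgamma)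
    (xi_hr : highest_root_of Delta Pi q lgamma xi)
    (V : {vspace tensor g g})
    (V_constituent : constituent Delta Pi q lgamma
       (centerv (nilrad Delta Pi q)) V (xi + gamma)) :
  ~ special Delta Pi q mu gamma (xi + gamma).
Proof.
exact (highest_roots_sum_not_special g_simple h_cartan DeltaP Pi_base T_type
  mu_hw gamma_hw lgammaP xi_hr).
Qed.
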